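(* Let $k\ge1$ and let $T_2^{\otimes k}$ be the group of $2^k\times2^k$ matrices $$\begin{bmatrix}t_1&0\\0&\overline{t_1}\end{bmatrix}\otimes\begin{bmatrix}t_2&0\\0&\overline{t_2}\end{bmatrix}\otimes\cdots\otimes\begin{bmatrix}t_k&0\\0&\overline{t_k}\end{bmatrix},\qquad t_r=e^{i\theta_r},\ \theta_r\in\mathbb R.$$ Let $F_{T_2^{\otimes k}}(q)=\sum_{d\ge0}q^d\dim\mathcal H_d$, where $\mathcal H_d$ is the space of homogeneous degree-$d$ polynomials $P\in\mathbb C[x_1,\dots,x_{2^k}]$ with $P(xA)=P(x)$ for all $A\in T_2^{\otimes k}$ ($x$ a row vector). Then $$F_{T_2^{\otimes k}}(q)=\frac{1}{\prod_{S\subseteq\{1,\dots,k\}}\Big(1-q\prod_{i\in S}a_i\big/\prod_{j\notin S}a_j\Big)}\Bigg|_{a_1^0a_2^0\cdots a_k^0}.$$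
   Context: The right side is understood by expanding each factor $1/(1-qM)$ as a geometric series in $q$; each coefficient of a power of $q$ is then a Laurent polynomial in $a_1,\dots,a_k$, and $|_{a_1^0\cdots a_k^0}$ takes its constant term in $a_1,\dots,a_k$. The tensor product is $A\otimes B=[a_{ij}B]$, iterated. *)

(* Defs.v *)
From HB Require Import structures.
From mathcomp Require Import all_boot all_order all_algebra.
From mathcomp Require Import complex mxtens.
From mathcomp.multinomials Require Import freeg mpoly.
From mathcomp Require Import boolp classical_sets reals trigo.

Set Implicit Arguments.
Unset Strict Implicit.
Unset Printing Implicit Defensive.

Import GRing.Theory Num.Theory.
Local Open Scope ring_scope.
Local Open Scope complex_scope.

Section Dimension.
Local Open Scope classical_set_scope.
Variables (K : fieldType) (V : lmodType K).
Implicit Types (H : set V) (m n : nat).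

Definition is_basis H n (e : 'I_n -> V) : Prop :=
  [/\ forall i, H (e i),
      forall c : 'I_n -> K, \sum_i c i *: e i = 0 -> forall i, c i = 0
    & forall v, H v -> exists c : 'I_n -> K, v = \sum_i c i *: e i].

(* The junk value 0 is taken only when H has no finite basis; see
   [dimension_unique] and [dimension_invariantsP]. *)
Definition dimension H : nat :=
  xget 0%N [set n | exists e : 'I_n -> V, is_basis H e].

Lemma free_le n m (e : 'I_n -> V) (g : 'I_m -> V) :
  (forall c : 'I_n -> K, \sum_i c i *: e i = 0 -> forall i, c i = 0) ->
  (forall i, exists c : 'I_m -> K, e i = \sum_j c j *: g j) ->
  (n <= m)%N.
Proof.
move=> free_e /choice[C eC].
pose M := \matrix_(i < n, j < m) C i j.
suff /eqP <- : row_free M by exact: rank_leq_col.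
rewrite -kermx_eq0.
apply/eqP/row_matrixP => r; rewrite row0.
have : row r (kermx M) *m M = 0 by rewrite -row_mul mulmx_ker row0.
move: (row r (kermx M)) => x xM0.
apply/rowP => i; rewrite mxE; apply: (free_e (fun i => x 0 i)).
under eq_bigr => l _ do rewrite eC scaler_sumr.
rewrite exchange_big big1 // => j _.
under eq_bigr => l _ do rewrite scalerA.
rewrite -scaler_suml.
have /rowP/(_ j) := xM0; rewrite !mxE.
by under eq_bigr => l _ do rewrite mxE; move=> ->; rewrite scale0r.
Qed.

Lemma dimension_unique H n (e : 'I_n -> V) : is_basis H e -> dimension H = n.
Proof.
move=> [eH fe se]; apply: xget_unique; first by exists e.
move=> m [f [fH ff sf]]; apply/eqP; rewrite eqn_leq; apply/andP; split.
  by apply: (free_le ff) => i; apply/se/fH.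
by apply: (free_le fe) => i; apply/sf/eH.
Qed.

Lemma dimensionP H m (g : 'I_m -> V) :
  (forall v, H v -> exists c : 'I_m -> K, v = \sum_j c j *: g j) ->
  exists e : 'I_(dimension H) -> V, is_basis H e.
Proof.
move=> Hg.
pose P n := exists e : 'I_n -> V, (forall i, H (e i)) /\
  (forall c : 'I_n -> K, \sum_i c i *: e i = 0 -> forall i, c i = 0).
have P0 : exists n, `[< P n >].
  by exists 0%N; apply/asboolP; exists (fun=> 0); split=> [[]|c _ []].
have Pm n : `[< P n >] -> (n <= m)%N.
  by move=> /asboolP[e [eH fe]]; apply: (free_le fe) => i; apply/Hg/eH.
case: (ex_maxnP P0 Pm) => n /asboolP[e [eH fe]] nmax.
have be : is_basis H e.
  split=> // v Hv; apply: contrapT => vNe.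
  have : (n.+1 <= n)%N; last by rewrite ltnn.
  apply: nmax; apply/asboolP.
  pose f (i : 'I_n.+1) := oapp e v (unlift ord0 i).
  exists f; split=> [i|c].
    by rewrite /f; case: (unlift ord0 i) => [j|] /=.
  rewrite big_ord_recl /f unlift_none /=.
  under eq_bigr => i _ do rewrite liftK /=.
  have [c00|c0N0] := eqVneq (c ord0) 0.
    rewrite c00 scale0r add0r => /fe ce i.
    by case: (unliftP ord0 i) => [j ->|->].
  move=> /eqP; rewrite addr_eq0 => /eqP cv; exfalso; apply: vNe.
  exists (fun i => - (c ord0)^-1 * c (fintype.lift ord0 i)).
  rewrite -[LHS]scale1r -(mulVf c0N0) -scalerA cv scalerN -scaleNr scaler_sumr.
  by apply: eq_bigr => i _; rewrite scalerA.
by rewrite (dimension_unique be); exists e.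
Qed.

End Dimension.

Section Invariants.
Local Open Scope classical_set_scope.
Variables (K : fieldType) (n : nat).
Implicit Types (G : set 'M[K]_n) (P : {mpoly K[n]}).

(* The polynomial P(xA): the row vector xA has j-th entry \sum_i x_i A_ij. *)
Definition mpoly_act (A : 'M[K]_n) P : {mpoly K[n]} :=
  P \mPo [tuple \sum_(i < n) A i j *: 'X_i | j < n].

Definition invariants G (d : nat) : set {mpoly K[n]} :=
  [set P | P \is d.-homog /\ forall A, G A -> mpoly_act A P = P].

Lemma dimension_invariantsP G d :
  exists e : 'I_(dimension (invariants G d)) -> {mpoly K[n]},
    is_basis (invariants G d) e.
Proof.
apply: (@dimensionP _ _ _ #|{: 'X_{1..n < d.+1}}|
          (fun j => 'X_[(enum_val j : 'X_{1..n < d.+1})])) => P [Pd _].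
exists (fun j => P@_(enum_val j : 'X_{1..n < d.+1})).
have le_P : (msize P <= d.+1)%N.
  have [->|P0] := eqVneq P 0; first by rewrite msize0.
  by rewrite -(dhomog_uniq P0 (dhomog_msize Pd) Pd) leqSpred.
rewrite {1}(mpolywE le_P).
rewrite -(big_enum_val (fun m : 'X_{1..n < d.+1} => P@_m *: 'X_[m])).
by apply: eq_bigl => m; rewrite inE.
Qed.

(* Coefficient sequence of the formal power series F_G(q). *)
Definition hilbert_series G : nat -> int :=
  fun d => (dimension (invariants G d))%:Z.

End Invariants.

Section TensorTorus.
Local Open Scope classical_set_scope.
Variable R : realType.

Definition expi (theta : R) : R[i] := cos theta +i* sin theta.

Definition torus2 (t : R[i]) : 'M[R[i]]_2 :=
  \matrix_(i, j) if i == j then (if i == 0 then t else t^*) else 0.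

(* A 0 *t (A 1 *t (... *t A k)), of size 2 ^ k.+1. *)
Fixpoint bigtensmx_rec (T : pzRingType) k :
    ('I_k.+1 -> 'M[T]_2) -> 'M[T]_(2 ^ k.+1) :=
  match k with
  | 0 => fun A => A ord0
  | k'.+1 => fun A => A ord0 *t bigtensmx_rec (fun i => A (fintype.lift ord0 i))
  end.

Definition bigtensmx (T : pzRingType) k : ('I_k -> 'M[T]_2) -> 'M[T]_(2 ^ k) :=
  match k with
  | 0 => fun=> 1%:M
  | k'.+1 => fun A => bigtensmx_rec A
  end.

Definition torus2_tens k : set 'M[R[i]]_(2 ^ k) :=
  [set bigtensmx (fun r => torus2 (expi (theta r))) | theta in [set: 'I_k -> R]].

End TensorTorus.

(* Group algebra of Z^k: a Laurent polynomial is a finite formal combination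
   of exponent vectors. *)
Definition laurent (R : comNzRingType) (k : nat) : Type :=
  {freeg {ffun 'I_k -> int} / R}.

Section Laurent.
Variables (R : comNzRingType) (k : nat).
Local Notation E := {ffun 'I_k -> int}.
Local Notation L := (laurent R k).
Implicit Types (p q r : L) (u v : E).

HB.instance Definition _ := Choice.on L.
HB.instance Definition _ := GRing.Zmodule.on L.

Definition laurent_coeff u p : R := coeff u p.

Definition laurent_const p : R := laurent_coeff 0 p.

Definition laurent_monom (c : R) u : L := << c *g u >>.

Definition laurent_mul p q : L :=
  \sum_(u <- dom p) \sum_(v <- dom q)
    laurent_monom (laurent_coeff u p * laurent_coeff v q) (u + v).

Lemma sum_dom (M : zmodType) (G : E -> R -> M) p (s : seq E) :
  (forall u, G u 0 = 0) -> uniq s -> {subset dom p <= s} ->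
  \sum_(u <- dom p) G u (coeff u p) = \sum_(u <- s) G u (coeff u p).
Proof.
move=> G0 us ps; rewrite [RHS](bigID (mem (dom p))) /=.
rewrite [X in _ + X]big1 ?addr0; last first.
  by move=> u; rewrite mem_dom negbK => /eqP ->.
rewrite -[RHS]big_filter; apply: perm_big; apply: uniq_perm.
- exact: uniq_dom.
- exact: filter_uniq.
by move=> u; rewrite mem_filter; case: (boolP (u \in dom p)) => // /ps ->.
Qed.

Lemma sum_domD (M : zmodType) (G : E -> R -> M) p q :
  (forall u, G u 0 = 0) -> (forall u, {morph G u : x y / x + y}) ->
  \sum_(u <- dom (p + q : L)) G u (coeff u (p + q : L)) =
  \sum_(u <- dom p) G u (coeff u p) + \sum_(u <- dom q) G u (coeff u q).
Proof.
move=> G0 GD; pose s := undup (dom p ++ dom q).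
have us : uniq s by exact: undup_uniq.
rewrite !(@sum_dom _ _ _ s) //.
- by rewrite -big_split; apply: eq_bigr => u _ /=; rewrite coeffD GD.
- by move=> u uq; rewrite mem_undup mem_cat uq orbT.
- by move=> u uq; rewrite mem_undup mem_cat uq.
- by move=> u /domD_subset; rewrite mem_undup.
Qed.

Lemma laurent_monomD c c' u :
  laurent_monom (c + c') u = laurent_monom c u + laurent_monom c' u.
Proof. by rewrite /laurent_monom -freegUD. Qed.

Lemma laurent_monom0 u : laurent_monom 0 u = 0.
Proof. exact: freegU0. Qed.

Lemma laurent_mulC : commutative laurent_mul.
Proof.
move=> p q; rewrite /laurent_mul exchange_big /=.
by apply: eq_bigr => u _; apply: eq_bigr => v _; rewrite mulrC addrC.
Qed.

Lemma laurent_mulDl : left_distributive laurent_mul +%R.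
Proof.
move=> p q r; rewrite /laurent_mul.
apply: (@sum_domD _ (fun u c => \sum_(v <- dom r)
  laurent_monom (c * laurent_coeff v r) (u + v))) => u.
  by rewrite big1 // => v _; rewrite mul0r laurent_monom0.
move=> x y; rewrite -big_split /=; apply: eq_bigr => v _.
by rewrite mulrDl laurent_monomD.
Qed.

Lemma laurent_mulDr : right_distributive laurent_mul +%R.
Proof.
by move=> p q r; rewrite laurent_mulC laurent_mulDl !(laurent_mulC p).
Qed.

Lemma laurent_mul0l : left_zero 0 laurent_mul.
Proof. by move=> p; rewrite /laurent_mul dom0 big_nil. Qed.

Lemma laurent_mul0r : right_zero 0 laurent_mul.
Proof. by move=> p; rewrite laurent_mulC laurent_mul0l. Qed.

Lemma laurent_mulUU c c' u v :
  laurent_mul (laurent_monom c u) (laurent_monom c' v) =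
  laurent_monom (c * c') (u + v).
Proof.
have [->|c0] := eqVneq c 0; first by rewrite mul0r !laurent_monom0 laurent_mul0l.
have [->|c'0] := eqVneq c' 0.
  by rewrite mulr0 !laurent_monom0 laurent_mul0r.
rewrite /laurent_mul /laurent_monom !domU // !big_seq1.
by rewrite /laurent_coeff !coeffU !eqxx !mulr1.
Qed.

Lemma laurent_ind (P : L -> Prop) : P 0 ->
  (forall c u p, P p -> P (laurent_monom c u + p)) -> forall p, P p.
Proof. by move=> P0 PD; elim/freeg_ind_dom0 => // c u p _ _; apply: PD. Qed.

Lemma laurent_mulA : associative laurent_mul.
Proof.
move=> p q r; elim/laurent_ind: p => [|a u p IHp]; first by rewrite !laurent_mul0l.
rewrite !laurent_mulDl IHp; congr (_ + _) => {p IHp}.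
elim/laurent_ind: q => [|b v q IHq]; first by rewrite !(laurent_mul0l,laurent_mul0r).
rewrite !(laurent_mulDl, laurent_mulDr) IHq; congr (_ + _) => {q IHq}.
elim/laurent_ind: r => [|c w r IHr]; first by rewrite !laurent_mul0r.
by rewrite !laurent_mulDr IHr !laurent_mulUU mulrA addrA.
Qed.

Lemma laurent_mul1l : left_id (laurent_monom 1 0) laurent_mul.
Proof.
elim/laurent_ind => [|c u p IHp]; first exact: laurent_mul0r.
by rewrite laurent_mulDr IHp laurent_mulUU mul1r add0r.
Qed.

Lemma laurent_oner_neq0 : laurent_monom 1 0 != 0.
Proof. by rewrite freegU_eq0 oner_eq0. Qed.

HB.instance Definition _ := GRing.Zmodule_isComNzRing.Build L
  laurent_mulA laurent_mulC laurent_mul1l laurent_mulDl laurent_oner_neq0.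

Definition laurent_unit : pred L := fun p => `[< exists q, q * p = 1 >].

(* As for any unitRingType, the inverse of a non-unit is itself. *)
Definition laurent_inv p : L := xget p [set q | q * p = 1]%classic.

Lemma laurent_mulVp : {in laurent_unit, left_inverse 1 laurent_inv *%R}.
Proof. by move=> p /asboolP; exact: xgetPex. Qed.

Lemma laurent_unitP p q : q * p = 1 -> laurent_unit p.
Proof. by move=> qp; apply/asboolP; exists q. Qed.

Lemma laurent_inv_out : {in [predC laurent_unit], laurent_inv =1 id}.
Proof.
move=> p /asboolP Np; rewrite /laurent_inv; case: xgetP => // q _ qp.
by case: Np; exists q.
Qed.

HB.instance Definition _ := GRing.ComNzRing_hasMulInverse.Build L
  laurent_mulVp laurent_unitP laurent_inv_out.

Definition laurent_var (i : 'I_k) : L :=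
  laurent_monom 1 [ffun j => (j == i)%:Z].

Lemma laurent_var_unit i : laurent_var i \is a GRing.unit.
Proof.
apply: (@laurent_unitP _ (laurent_monom 1 (- [ffun j => (j == i)%:Z]))).
by rewrite [LHS]laurent_mulUU mulr1 addNr.
Qed.

End Laurent.

(* A formal power series in q over L is its coefficient sequence. *)
Section PowerSeries.
Variable L : comNzRingType.
Implicit Types (s t : nat -> L) (M : L).

Definition fps_one : nat -> L := fun n => (n == 0%N)%:R.

Definition fps_mul s t : nat -> L := fun n => \sum_(i < n.+1) s i * t (n - i)%N.

(* 1 - q M *)
Definition fps_1subqM M : nat -> L :=
  fun n => if n is n'.+1 then if n' is 0 then - M else 0 else 1.

(* 1 / (1 - q M), expanded as \sum_n q^n M^n *)
Definition fps_geom M : nat -> L := fun n => M ^+ n.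

Lemma fps_mulE s t n N : (n <= N)%N ->
  fps_mul s t n = ((\poly_(i < N.+1) s i) * \poly_(i < N.+1) t i)`_n.
Proof.
move=> nN; rewrite coefM; apply: eq_bigr => i _.
by rewrite !coef_poly !ltnS (leq_trans (leq_subr _ _) nN)
  (leq_trans (leq_ord i) nN).
Qed.

Lemma fps_mulC : commutative fps_mul.
Proof. by move=> s t; apply/funext => n; rewrite !(fps_mulE _ _ (leqnn n)) mulrC. Qed.

Lemma fps_mulA : associative fps_mul.
Proof.
move=> s t r; apply/funext => n.
transitivity (((\poly_(i < n.+1) s i) *
  ((\poly_(i < n.+1) t i) * \poly_(i < n.+1) r i))`_n).
  rewrite coefM; apply: eq_bigr => i _.
  by rewrite coef_poly ltn_ord (fps_mulE _ _ (leq_subr i n)).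
rewrite mulrA coefM; apply: eq_bigr => i _.
by rewrite coef_poly ltnS leq_subr (fps_mulE _ _ (leq_ord i)).
Qed.

Lemma fps_mul1 : left_id fps_one fps_mul.
Proof.
move=> s; apply/funext => n; rewrite /fps_mul big_ord_recl /fps_one mul1r subn0.
by rewrite big1 ?addr0 // => i _; rewrite mul0r.
Qed.

HB.instance Definition _ :=
  Monoid.isComLaw.Build (nat -> L) fps_one fps_mul fps_mulA fps_mulC fps_mul1.

Lemma fps_geomP M : fps_mul (fps_1subqM M) (fps_geom M) = fps_one.
Proof.
apply/funext => -[|n]; rewrite /fps_mul big_ord_recl /= /fps_geom /fps_one.
  by rewrite big_ord0 addr0 mul1r.
rewrite big_ord_recl big1 ?addr0 => [|i _]; last by rewrite mul0r.
by rewrite mul1r subn0 /= subn1 mulNr -exprS subrr.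
Qed.

Lemma fps_prod_geomP (I : finType) (M : I -> L) :
  fps_mul (\big[fps_mul/fps_one]_i fps_1subqM (M i))
          (\big[fps_mul/fps_one]_i fps_geom (M i)) = fps_one.
Proof. by rewrite -big_split /= big1 // => i _; exact: fps_geomP. Qed.

End PowerSeries.

(* Main.v *)
Require Import Defs.
From mathcomp Require Import all_boot all_order all_algebra.
From mathcomp Require Import complex mxtens.
From mathcomp.multinomials Require Import freeg mpoly.
From mathcomp Require Import boolp classical_sets reals trigo.

(* By bigtensmxE the torus acts diagonally: the variable indexed by a subset S
   is scaled by prod_(r in S) t_r * prod_(r notin S) t_r^-1, the character of
   exponent vector pm_exponent S.  Hence every monomial spans a line on which the
   torus acts by the character whose exponent vector is its weight, and since
   nontrivial characters of the torus are nonconstant, the monomials of degree d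
   and weight 0 form a basis of the invariants.  In the coefficient of q^d of the
   product of geometric series, each monomial of degree d contributes the Laurent
   monomial of its weight, so the constant term counts the same monomials. *)

Set Implicit Arguments.
Unset Strict Implicit.
Unset Printing Implicit Defensive.

Import Order.TTheory GRing.Theory Num.Theory.
Local Open Scope ring_scope.
Local Open Scope complex_scope.

(** * Entries of iterated tensor products *)

Lemma bigtensmx_recE (T : pzRingType) k :
  exists2 phi : 'I_(2 ^ k.+1) -> {ffun 'I_k.+1 -> 'I_2}, bijective phi &
    forall (A : 'I_k.+1 -> 'M[T]_2) i j,
      bigtensmx_rec A i j = \prod_r A r (phi i r) (phi j r).
Proof.
elim: k => [|k [phi phi_bij phiE]].
  exists (fun i => [ffun => i]).
    apply: inj_card_bij; last by rewrite card_ffun !card_ord.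
    by move=> i j /ffunP/(_ ord0); rewrite !ffunE.
  by move=> A i j; rewrite big_ord1 !ffunE.
(* [psi] lists the binary digits of an index: [mxtens_unindex] splits off the digit of the leading
   factor, and [phi] reads the digits of the rest. *)
pose psi (i : 'I_(2 * 2 ^ k.+1)) : {ffun 'I_k.+2 -> 'I_2} :=
  [ffun r => oapp (phi (mxtens_unindex i).2) (mxtens_unindex i).1
                  (unlift ord0 r)].
have psi0 i : psi i ord0 = (mxtens_unindex i).1 by rewrite ffunE unlift_none.
have psiS i r : psi i (fintype.lift ord0 r) = phi (mxtens_unindex i).2 r.
  by rewrite ffunE liftK.
exists psi.
  apply: inj_card_bij; last by rewrite card_ffun !card_ord.
  move=> i j eq_psi; apply: (can_inj (@mxtens_unindexK _ _)).
  have: psi i ord0 = psi j ord0 by rewrite eq_psi.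
  rewrite !psi0.
  have: (mxtens_unindex i).2 = (mxtens_unindex j).2.
    by apply: (bij_inj phi_bij); apply/ffunP => r; rewrite -!psiS eq_psi.
  by case: (mxtens_unindex i) (mxtens_unindex j) => [? ?] [? ?] /= -> ->.
move=> A i j; rewrite big_ord_recl !psi0.
under eq_bigr do rewrite !psiS.
rewrite -(phiE (fun r => A (fintype.lift ord0 r))).
by rewrite -tensmxE !mxtens_unindexK.
Qed.

Lemma bigtensmxE (T : pzRingType) k :
  exists2 phi : 'I_(2 ^ k) -> {ffun 'I_k -> 'I_2}, bijective phi &
    forall (A : 'I_k -> 'M[T]_2) i j,
      bigtensmx A i j = \prod_r A r (phi i r) (phi j r).
Proof.
case: k => [|k]; last exact: bigtensmx_recE.
exists (fun=> [ffun=> ord0]).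
  apply: inj_card_bij; last by rewrite card_ffun !card_ord.
  by move=> i j _; rewrite (ord1 i) (ord1 j).
by move=> A i j; rewrite big_ord0 (ord1 i) (ord1 j) mxE.
Qed.

(** * Diagonal actions and spaces spanned by monomials *)

Lemma mpoly_act_diag (K : fieldType) n (A : 'M[K]_n) (P : {mpoly K[n]}) m :
  is_diag_mx A -> (mpoly_act A P)@_m = (\prod_i A i i ^+ m i) * P@_m.
Proof.
move=> /is_diag_mxP A_diag.
(* A diagonal substitution sends ['X_i] to [A i i *: 'X_i], so every monomial is an eigenvector. *)
have -> : mpoly_act A P =
    \sum_(u <- msupp P) (P@_u * \prod_i A i i ^+ u i) *: 'X_[u].
  rewrite /mpoly_act comp_mpolyE; apply: eq_bigr => u _.
  rewrite -scalerA; congr (_ *: _).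
  rewrite mpolyXE_id -scaler_prod; apply: eq_bigr => i _.
  rewrite tnth_mktuple (bigD1 i) //= big1 ?addr0 ?exprZn // => j ji.
  by rewrite A_diag ?scale0r //.
rewrite raddf_sum /=.
have [mP|mP] := boolP (m \in msupp P); last first.
  rewrite big_seq big1 => [|u uP].
    by move: mP; rewrite -mcoeff_eq0 => /eqP ->; rewrite mulr0.
  rewrite mcoeffZ mcoeffX; case: eqP => [um|_]; last exact: mulr0.
  by rewrite -um uP in mP.
rewrite (bigD1_seq m) //= mcoeffZ mcoeffX eqxx mulr1 [X in _ + X]big1 ?addr0 1?mulrC //.
by move=> u /negPf um; rewrite mcoeffZ mcoeffX um mulr0.
Qed.

(** The monomials allowed by [W] form a basis. In degree [d] no exponent exceeds [d], so functions
    into ['I_d.+1] encode them all; the expansion of the geometric series has the same index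
    type. *)
Lemma dimension_monomials (K : fieldType) n d (W : pred 'X_{1..n}) :
  dimension [set P : {mpoly K[n]} |
    P \is d.-homog /\ forall m, P@_m != 0 -> W m]%classic =
  #|[set f : {ffun 'I_n -> 'I_d.+1} |
      (\sum_i f i == d)%N && W [multinom (f i : nat) | i < n]]|.
Proof.
set B := [set f : {ffun _} | _].
pose mnm (f : {ffun 'I_n -> 'I_d.+1}) := [multinom (f i : nat) | i < n].
have mnm_inj : injective mnm.
  move=> f g /mnmP fg; apply/ffunP => i; apply/val_inj.
  by have := fg i; rewrite !mnmE.
have mnmK m : (mdeg m = d)%N -> mnm [ffun i => inord (m i)] = m.
  move=> md; apply/mnmP => i; rewrite mnmE ffunE inordK // ltnS -md mdegE.
  by rewrite (bigD1 i) //= leq_addr.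
have mdeg_mnm f : mdeg (mnm f) = (\sum_i f i)%N.
  by rewrite mdegE; apply: eq_bigr => i _; rewrite mnmE.
pose e (j : 'I_#|B|) : {mpoly K[n]} := 'X_[mnm (enum_val j)].
have eE (c : 'I_#|B| -> K) m : (\sum_j c j *: e j)@_m =
    \sum_j c j * (mnm (enum_val j) == m)%:R.
  by rewrite raddf_sum; apply: eq_bigr => j _; rewrite /= mcoeffZ mcoeffX.
have eE_val (c : 'I_#|B| -> K) j :
    (\sum_j c j *: e j)@_(mnm (enum_val j)) = c j.
  rewrite eE (bigD1 j) //= eqxx mulr1 big1 ?addr0 // => i /negPf ij.
  by rewrite (inj_eq mnm_inj) (inj_eq enum_val_inj) ij mulr0.
apply: (@dimension_unique _ _ _ _ e); split=> [j|c c0 j|P [Pd PW]].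
- have /[!inE]/andP[/eqP jd jW] := enum_valP j.
  split; first by rewrite dhomogX; apply/eqP; exact: etrans (mdeg_mnm _) jd.
  by move=> m; rewrite mcoeffX; have [<- //|_] := eqVneq (mnm _) m; rewrite eqxx.
- by rewrite -(eE_val c) c0 mcoeff0.
- exists (fun j => P@_(mnm (enum_val j))); apply/mpolyP => m.
  have [P0|PN0] := eqVneq P@_m 0.
    rewrite eE big1 // => j _; case: eqP => [->|_]; last exact: mulr0.
    by rewrite P0 mul0r.
  have md : mdeg m = d by apply: (dhomogP _ _ _ Pd); rewrite mcoeff_msupp.
  have mB : [ffun i => inord (m i)] \in B.
    by rewrite inE -/(mnm _) -mdeg_mnm mnmK // md eqxx PW.
  rewrite -[in RHS](mnmK _ md) -(enum_rankK_in mB mB) eE_val.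
  by rewrite (enum_rankK_in mB mB) mnmK.
Qed.

(** * Coefficients of products of power series *)

Lemma big_fps_mulE (L : comNzRingType) (I : finType) (s : I -> nat -> L) d N :
  (d <= N)%N ->
  (\big[@fps_mul L/fps_one L]_i s i) d = (\prod_i \poly_(j < N.+1) s i j)`_d.
Proof.
(* The truncation order [N] stays fixed while [d] varies, since the coefficient at [d] calls on all
   lower coefficients of the remaining product. *)
move=> dN; elim/big_rec2: _ d dN => [|i p t _ IH] d dN; first by rewrite coef1.
rewrite coefM; apply: eq_bigr => j _.
by rewrite coef_poly ltnS (leq_trans (leq_ord j) dN) IH // (leq_trans (leq_subr _ _)).
Qed.

(** Distributivity picks one power [f i] from each truncated series, and only choices of total
    degree [d] reach the coefficient of [q^d]. *)
Lemma big_fps_geomE (L : comNzRingType) (I : finType) (M : I -> L) d :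
  (\big[@fps_mul L/fps_one L]_i fps_geom (M i)) d =
  \sum_(f : {ffun I -> 'I_d.+1} | (\sum_i f i == d)%N) \prod_i M i ^+ f i.
Proof.
rewrite (big_fps_mulE _ (leqnn d)).
under eq_bigr do rewrite poly_def.
rewrite bigA_distr_bigA /= coef_sum [RHS]big_mkcond /=.
apply: eq_bigr => f _; rewrite scaler_prod /fps_geom coefZ -expr_sum coefXn eq_sym.
by case: eqP => _; rewrite ?mulr1 ?mulr0.
Qed.

(** * Laurent monomials and their exponent vectors *)

Definition pm_exponent k (S : {set 'I_k}) : {ffun 'I_k -> int} :=
  [ffun r => if r \in S then 1 else -1].

Section LaurentMonomials.
Variables (R : comNzRingType) (k : nat).
Local Notation E := {ffun 'I_k -> int}.
Local Notation mon := (laurent_monom (1 : R)).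

Lemma laurent_monom1D (u v : E) : mon (u + v) = mon u * mon v.
Proof. by rewrite [RHS]laurent_mulUU mulr1. Qed.

Lemma laurent_monom_sum (I : Type) (s : seq I) (P : pred I) (u : I -> E) :
  mon (\sum_(i <- s | P i) u i) = \prod_(i <- s | P i) mon (u i).
Proof. exact: (big_morph _ laurent_monom1D). Qed.

Lemma laurent_monomMn (u : E) n : mon (u *+ n) = mon u ^+ n.
Proof. by elim: n => // n IH; rewrite mulrS exprS -IH laurent_monom1D. Qed.

Lemma laurent_monomN (u : E) : mon (- u) = (mon u)^-1.
Proof.
have monNK : mon (- u) * mon u = 1 by rewrite -laurent_monom1D addNr.
have mon_unit : mon u \is a GRing.unit by apply: laurent_unitP monNK.
(* The ring inverse is obtained by choice, so it is identified by cancelling the unit [mon u]. *)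
by apply: (mulIr mon_unit); rewrite mulVr.
Qed.

Lemma laurent_const_monom (u : E) : laurent_const (mon u) = (u == 0)%:R.
Proof. by rewrite /laurent_const /laurent_coeff coeffU mul1r. Qed.

Lemma laurent_var_quotient (S : {set 'I_k}) :
  (\prod_(i in S) laurent_var R i) / (\prod_(j in ~: S) laurent_var R j) =
  mon (pm_exponent S).
Proof.
rewrite -!laurent_monom_sum -laurent_monomN -laurent_monom1D.
congr (laurent_monom _ _); apply/ffunP => r.
rewrite !ffunE !sum_ffunE.
(* Numerator and denominator have as exponent vectors the indicators of [S] and of its complement;
   their difference is 1 on [S] and -1 off it. *)
have sumE (A : {set 'I_k}) :
    \sum_(i in A) [ffun j : 'I_k => (j == i)%:Z] r = (r \in A)%:Z.
  under eq_bigr do rewrite ffunE.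
  have [rA|rA] := boolP (r \in A).
    rewrite (bigD1 r) //= eqxx big1 ?addr0 // => i /andP[_ /negPf].
    by rewrite eq_sym => ->.
  by rewrite big1 // => i iA; case: eqP => // ri; rewrite ri iA in rA.
by rewrite !sumE inE; case: (r \in S).
Qed.

End LaurentMonomials.

(** * Characters of the torus *)

Section UnitCircle.
Variable R : realType.

Lemma expi0 : expi (0 : R) = 1.
Proof. by rewrite /expi cos0 sin0. Qed.

Lemma expiD (x y : R) : expi (x + y) = expi x * expi y.
Proof. by rewrite /expi cosD sinD; simpc; rewrite [X in _ +i* X]addrC. Qed.

Lemma expi_conj (x : R) : conjc (expi x) = expi (- x).
Proof. by rewrite /expi cosN sinN. Qed.

Lemma expi_sum (I : Type) (s : seq I) (P : pred I) (x : I -> R) :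
  expi (\sum_(i <- s | P i) x i) = \prod_(i <- s | P i) expi (x i).
Proof. exact: (big_morph _ expiD expi0). Qed.

Lemma expiMn (x : R) n : expi (x *+ n) = expi x ^+ n.
Proof.
elim: n => [|n IH]; first by rewrite expi0.
by rewrite mulrS exprS -IH expiD.
Qed.

Lemma expi_pi_neq1 : expi (pi : R) != 1.
Proof.
rewrite /expi cospi sinpi; apply/eqP => -[/eqP].
by rewrite eq_sym -subr_eq0 opprK (pnatr_eq0 _ 2).
Qed.

Lemma expi_character_trivial k (u : {ffun 'I_k -> int}) :
  (forall x : 'I_k -> R, expi (\sum_r x r *~ u r) = 1) <-> u = 0.
Proof.
split=> [u1|-> x]; last by rewrite big1 ?expi0 // => r _; rewrite ffunE.
apply/ffunP => r; rewrite ffunE; apply/eqP/negP => /negP ur.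
(* With these angles only the term at [r] survives, and it equals [pi], where [expi] is -1. *)
have /eqP := u1 (fun s => if s == r then pi / (u r)%:~R else 0).
rewrite (bigD1 r) //= eqxx big1 ?addr0 => [|s /negPf ->]; last exact: mul0rz.
by rewrite -mulrzr divfK ?intr_eq0 // (negPf expi_pi_neq1).
Qed.

End UnitCircle.

(** * The tensor torus and its invariants *)

Lemma torus2_tensE (R : realType) k :
  exists2 S : 'I_(2 ^ k) -> {set 'I_k}, bijective S &
    forall theta : 'I_k -> R,
      let A := bigtensmx (fun r => torus2 (expi (theta r))) in
      is_diag_mx A /\
      forall i, A i i = expi (\sum_r theta r *~ pm_exponent (S i) r).
Proof.
have [phi phi_bij phiE] := bigtensmxE R[i] k.
(* Digit 0 selects the entry [t_r] and digit 1 its conjugate, which is the inverse of [t_r] on the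
   unit circle. *)
exists (fun i => [set r | phi i r == 0]).
  apply: inj_card_bij.
    move=> i j eq_ij; apply: (bij_inj phi_bij); apply/ffunP => r.
    have := congr1 (fun S : {set _} => r \in S) eq_ij; rewrite !inE.
    by case: (phi i r) (phi j r) => [[|[|?]] ?] [[|[|?]] ?] //= _; apply/val_inj.
  by rewrite -cardsT -powersetT card_powerset cardsT !card_ord.
move=> theta A; split=> [|i].
  apply/is_diag_mxP => i j ij.
  (* Distinct indices differ in some digit, and the factor there is an off-diagonal entry of
     [torus2], hence 0. *)
  have [r phi_r] : exists r, phi i r != phi j r.
    apply/existsP; rewrite -negb_forall; apply: contra ij => /forallP eq_phi.
    by apply/eqP; congr (val _); apply: (bij_inj phi_bij); apply/ffunP => r; apply/eqP.
  by rewrite /A phiE (bigD1 r) //= mxE (negPf phi_r) mul0r.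
rewrite /A phiE expi_sum; apply: eq_bigr => r _.
rewrite mxE eqxx ffunE inE; case: (phi i r == 0); rewrite ?mulr1z //.
by rewrite mulrN1z expi_conj.
Qed.

(** Coefficientwise, invariance says that the character of the weight of [m] fixes [P@_m]; where
    [P@_m] is nonzero, cancelling it makes the character trivial. *)
Lemma invariants_torus2_tens (R : realType) k :
  exists2 S : 'I_(2 ^ k) -> {set 'I_k}, bijective S &
    forall d, invariants (@torus2_tens R k) d =
      [set P | P \is d.-homog /\ forall m, P@_m != 0 ->
        \sum_i pm_exponent (S i) *+ m i == 0]%classic.
Proof.
have [S S_bij SE] := torus2_tensE R k; exists S => // d.
pose wt (m : 'X_{1..2 ^ k}) := \sum_i pm_exponent (S i) *+ m i.
have actE (P : {mpoly R[i][2 ^ k]}) m theta :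
    (mpoly_act (bigtensmx (fun r => torus2 (expi (theta r)))) P)@_m =
    expi (\sum_r theta r *~ wt m r) * P@_m.
  have [A_diag AE] := SE theta; rewrite mpoly_act_diag //; congr (_ * _).
  under eq_bigr do rewrite AE -expiMn.
  rewrite -expi_sum; congr expi.
  (* Collecting the angles by tensor factor [r] instead of by variable [i] brings out [wt m]. *)
  under eq_bigr do rewrite -sumrMnl.
  rewrite exchange_big; apply: eq_bigr => r _ /=.
  rewrite sum_ffunE mulrz_sumr; apply: eq_bigr => i _.
  by rewrite ffunMnE pmulrn -mulrzA -mulrzz pmulrn.
apply/seteqP; split=> P [Pd PG]; split=> //.
  move=> m mP; apply/eqP/(expi_character_trivial R) => theta.
  by apply: (mulIf mP); rewrite mul1r -actE PG //; exists theta.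
move=> _ [theta _ <-]; apply/mpolyP => m; rewrite actE.
have [->|/PG/eqP wt0] := eqVneq P@_m 0; first by rewrite mulr0.
by rewrite [wt m]wt0 (expi_character_trivial R 0).2 ?mul1r.
Qed.

Theorem theorem2p2 (R : realType) (k : nat) (k_gt0 : (0 < k)%N) :
  hilbert_series (@torus2_tens R k) =
  fun d : nat =>
    laurent_const
      ((\big[@fps_mul _/fps_one (laurent int k)]_(S : {set 'I_k})
          fps_geom ((\prod_(i in S) laurent_var int i) /
                    (\prod_(j in ~: S) laurent_var int j))) d).
Proof.
apply/funext => d; rewrite /hilbert_series.
have [S S_bij ->] := invariants_torus2_tens R k.
rewrite (dimension_monomials _ _ (fun m => \sum_i pm_exponent (S i) *+ m i == 0)).
(* The factors are now indexed by the variables, so both sides run over the same exponent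
   functions. *)
rewrite (reindex S) /=; last exact: onW_bij.
under eq_bigr do rewrite laurent_var_quotient.
rewrite big_fps_geomE /laurent_const /laurent_coeff raddf_sum /=.
(* The weight condition moves from the range of the count into a 0/1 summand, to be matched with the
   constant term of a single Laurent monomial. *)
rewrite -sum1dep_card -[LHS]natz natr_sum big_mkcondr; apply: eq_bigr => f _.
under [in RHS]eq_bigr do rewrite -laurent_monomMn.
rewrite -laurent_monom_sum -[RHS]/(laurent_const _) laurent_const_monom.
under eq_bigr do rewrite mnmE.
by case: eqP.
Qed.
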